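(* Let $r\ge 2$. Let $p_{n,\ell}^{(r)}$ be the total number of peaks at level $\ell+1$ over all paths in $\mathcal{A}_{n+1,0}^{(r)}$. Then for all integers $n\ge\ell\ge 0$, $$p_{n,\ell}^{(r)}=\sum_{j=0}^{n-\ell}\frac{2r(\ell+1)}{2n-j+2}\binom{2n-j+2}{n-\ell}\binom{n-\ell}{j}(r-1)^{n-j},$$ with $p_{0,0}^{(r)}=r$. Moreover, $p_{n,\ell}^{(r)}$ is the $(n,\ell)$-entry of the Riordan array $\left(rS_r(x)^2,\ x(r-1)S_r(x)^2\right)$, i.e. $p_{n,\ell}^{(r)}=[x^n]\,rS_r(x)^2\left(x(r-1)S_r(x)^2\right)^{\ell}$.
   Context: A Dyck path of length $2n$ is a lattice path from $(0,0)$ to $(2n,0)$ weakly above the $x$-axis with steps $\mathbf{u}=(1,1)$, $\mathbf{d}=(1,-1)$; an $r$-colored Dyck path has each $\mathbf{d}$-step colored with one of $r$ colors. $\mathcal{A}_{n,0}^{(r)}$ is the set of $r$-colored Dyck paths of length $2n$ with no two consecutive $\mathbf{d}$-steps of the same color. A peak is an occurrence of a $\mathbf{u}$-step immediately followed by a $\mathbf{d}$-step; its level is the ordinate of the common point of the two steps. $S_r(x)=\frac{1-x-\sqrt{(1-x)^2-4(r-1)x}}{2(r-1)x}$ is the unique power series with $S_r=1+xS_r+(r-1)xS_r^2$. A Riordan array $(d(x),h(x))$ is the matrix with $(n,k)$-entry $[x^n]d(x)h(x)^k$. *)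

(* Defs.v *)
From HB Require Import structures.
From mathcomp Require Import all_boot all_order all_algebra ring.
From mathcomp Require Import boolp.

Set Implicit Arguments.
Unset Strict Implicit.
Unset Printing Implicit Defensive.

Import Order.TTheory GRing.Theory Num.Theory.
Local Open Scope ring_scope.

Record fps (R : Type) := Fps { fcoef : nat -> R }.

HB.instance Definition _ (R : Type) := gen_eqMixin (fps R).
HB.instance Definition _ (R : Type) := gen_choiceMixin (fps R).

Lemma fpsP (R : Type) (f g : fps R) : fcoef f =1 fcoef g -> f = g.
Proof. by case: f g => [f] [g] /= /funext ->. Qed.

Section FpsRing.
Variable R : comNzRingType.
Implicit Types f g h : fps R.

Definition fps0 : fps R := Fps (fun=> 0).
Definition fps1 : fps R := Fps (fun n => (n == 0%N)%:R).
Definition fpsX : fps R := Fps (fun n => (n == 1%N)%:R).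
Definition fps_opp f : fps R := Fps (fun n => - fcoef f n).
Definition fps_add f g : fps R := Fps (fun n => fcoef f n + fcoef g n).
Definition fps_mul f g : fps R :=
  Fps (fun n => \sum_(i < n.+1) fcoef f i * fcoef g (n - i)%N).

Fact fps_addA : associative fps_add.
Proof. by move=> f g h; apply: fpsP => n /=; rewrite addrA. Qed.
Fact fps_addC : commutative fps_add.
Proof. by move=> f g; apply: fpsP => n /=; rewrite addrC. Qed.
Fact fps_add0 : left_id fps0 fps_add.
Proof. by move=> f; apply: fpsP => n /=; rewrite add0r. Qed.
Fact fps_addN : left_inverse fps0 fps_opp fps_add.
Proof. by move=> f; apply: fpsP => n /=; rewrite addNr. Qed.

HB.instance Definition _ :=
  GRing.isZmodule.Build (fps R) fps_addA fps_addC fps_add0 fps_addN.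

Definition fps_trunc (N : nat) f : {poly R} := \poly_(i < N) fcoef f i.

Lemma coef_trunc_mul N f g k : (k < N)%N ->
  fcoef (fps_mul f g) k = (fps_trunc N f * fps_trunc N g)`_k.
Proof.
move=> kN; rewrite coefM; apply: eq_bigr => i _; rewrite !coef_poly.
by rewrite !(leq_ltn_trans _ kN) ?leq_subr // -ltnS ltn_ord.
Qed.

Fact fps_mulA : associative fps_mul.
Proof.
move=> f g h; apply: fpsP => n.
pose T := fps_trunc n.+1.
transitivity ((T f * (T g * T h))`_n).
  rewrite coefM; apply: eq_bigr => i _.
  rewrite -coef_trunc_mul ?ltnS ?leq_subr // coef_poly.
  by rewrite ltn_ord.
rewrite mulrA coefM; apply: eq_bigr => i _.
by rewrite -coef_trunc_mul ?ltn_ord // coef_poly ltnS leq_subr.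
Qed.

Fact fps_mulC : commutative fps_mul.
Proof.
move=> f g; apply: fpsP => n.
by rewrite !(coef_trunc_mul _ _ (ltnSn n)) mulrC.
Qed.

Fact fps_mul1 : left_id fps1 fps_mul.
Proof.
move=> f; apply: fpsP => n /=.
rewrite big_ord_recl /= mul1r subn0 big1 ?addr0 // => i _.
by rewrite mul0r.
Qed.

Fact fps_mulDl : left_distributive fps_mul fps_add.
Proof.
move=> f g h; apply: fpsP => n /=; rewrite -big_split /=.
by apply: eq_bigr => i _; rewrite mulrDl.
Qed.

Fact fps1_neq0 : fps1 != 0 :> fps R.
Proof.
apply/eqP => /(congr1 (fun f => fcoef f 0%N)) /= /eqP.
by rewrite oner_eq0.
Qed.

HB.instance Definition _ := GRing.Zmodule_isComNzRing.Build (fps R)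
  fps_mulA fps_mulC fps_mul1 fps_mulDl fps1_neq0.

Lemma fcoefD f g n : fcoef (f + g) n = fcoef f n + fcoef g n.
Proof. by []. Qed.

Lemma fcoefM f g n :
  fcoef (f * g) n = \sum_(i < n.+1) fcoef f i * fcoef g (n - i)%N.
Proof. by []. Qed.

Lemma fcoefXM f n :
  fcoef (fpsX * f) n = if n is m.+1 then fcoef f m else 0.
Proof.
rewrite fcoefM big_ord_recl /= mul0r add0r.
case: n => [|n]; first by rewrite big_ord0.
rewrite big_ord_recl /= mul1r subn1 /= big1 ?addr0 // => i _.
by rewrite mul0r.
Qed.

Definition riordan (d h : fps R) (n k : nat) : R := fcoef (d * h ^+ k) n.

End FpsRing.

Arguments fpsX {R}.

Section SchroederSeries.
Variable r : nat.

Definition Sr_step (T : fps rat) : fps rat :=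
  1 + fpsX * T + (r%:R - 1) * fpsX * T ^+ 2.

(* The coefficient of x^n is stationary from the (n+1)-st iterate on. *)
Definition Sr : fps rat := Fps (fun n => fcoef (iter n.+1 Sr_step 0) n).

Lemma Sr_step_agree N (T U : fps rat) :
  (forall k, (k < N)%N -> fcoef T k = fcoef U k) ->
  forall k, (k < N.+1)%N -> fcoef (Sr_step T) k = fcoef (Sr_step U) k.
Proof.
move=> TU k kN.
have E V : Sr_step V = 1 + fpsX * (V + (r%:R - 1) * (V * V)).
  by rewrite /Sr_step; ring.
rewrite !E !(fcoefD 1) !fcoefXM; case: k kN => // k; rewrite ltnS => kN.
congr (_ + _); rewrite !(fcoefD _ (_ * _)) TU //; congr (_ + _).
rewrite !(fcoefM (_ - _)); apply: eq_bigr => i _; congr (_ * _).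
rewrite !fcoefM; apply: eq_bigr => j _.
have ki : (k - i < N)%N by rewrite (leq_ltn_trans (leq_subr _ _)).
by rewrite !TU // (leq_ltn_trans _ ki) ?leq_subr // -ltnS ltn_ord.
Qed.

Lemma Sr_iter N k : (k < N)%N -> fcoef Sr k = fcoef (iter N Sr_step 0) k.
Proof.
have H m M : forall j, (j < M)%N ->
    fcoef (iter M Sr_step 0) j = fcoef (iter (m + M) Sr_step 0) j.
  elim: M => // M IH j jM; rewrite addnS /=.
  exact: (Sr_step_agree IH).
by move=> kN; rewrite -(subnK kN); apply: H.
Qed.

Lemma Sr_eq : Sr = 1 + fpsX * Sr + (r%:R - 1) * fpsX * Sr ^+ 2.
Proof.
apply: fpsP => n.
rewrite (Sr_iter (ltnSn n)) -[RHS]/(fcoef (Sr_step Sr) n) iterS.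
apply: (@Sr_step_agree n _ _ _ n (ltnSn n)) => k kn.
by rewrite (Sr_iter kn).
Qed.

Lemma Sr_unique (T : fps rat) :
  T = 1 + fpsX * T + (r%:R - 1) * fpsX * T ^+ 2 -> T = Sr.
Proof.
move=> TE; apply: fpsP => n.
suff H N : forall k, (k < N)%N -> fcoef T k = fcoef Sr k by apply: (H n.+1).
elim: N => // N IH k kN.
by rewrite TE [in RHS]Sr_eq; apply: (Sr_step_agree IH).
Qed.

(* [Q = 1 - x - 2 (r-1) x S_r] is the square root of
   [(1-x)^2 - 4 (r-1) x] with constant term 1. *)
Lemma Sr_closed_form (Q := 1 - fpsX - 2 * (r%:R - 1) * fpsX * Sr) :
  Q ^+ 2 = (1 - fpsX) ^+ 2 - 4 * (r%:R - 1) * fpsX /\ fcoef Q 0 = 1.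
Proof.
split; last first.
  have -> : Q = 1 + fpsX * (- 1 - 2 * (r%:R - 1) * Sr) by rewrite /Q; ring.
  by rewrite fcoefD fcoefXM addr0.
pose E := 1 + fpsX * Sr + (r%:R - 1) * fpsX * Sr ^+ 2 - Sr.
have E0 : E = 0 by rewrite /E -Sr_eq subrr.
have -> : Q ^+ 2 = (1 - fpsX) ^+ 2 - 4 * (r%:R - 1) * fpsX
                   + 4 * (r%:R - 1) * fpsX * E by rewrite /Q /E; ring.
by rewrite E0 mulr0 addr0.
Qed.

End SchroederSeries.

(* [None] is the step u = (1,1); [Some c] is the step d = (1,-1) of color c. *)
Definition step (r : nat) : finType := option 'I_r.

Definition is_u r (s : step r) : bool := s == None.
Definition is_d r (s : step r) : bool := s != None.

(* Ordinate of the endpoint of a path that starts at (0,0). *)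
Definition ordinate r (w : seq (step r)) : int :=
  \sum_(s <- w) (if is_u s then 1 else - 1).

Definition dyck r (w : seq (step r)) : bool :=
  (ordinate w == 0) &&
  all (fun i => 0 <= ordinate (take i w)) (iota 0 (size w).+1).

Definition no_mono_dd r (w : seq (step r)) : bool :=
  sorted (fun s t => ~~ [&& is_d s, is_d t & s == t]) w.

Definition An0 (r n : nat) : {set (2 * n).-tuple (step r)} :=
  [set w : (2 * n).-tuple (step r) | dyck w && no_mono_dd w].

Definition peaks_at r (w : seq (step r)) (level : nat) : nat :=
  count (fun i => [&& (i.+1 < size w)%N, is_u (nth None w i),
                      is_d (nth None w i.+1)
                    & ordinate (take i.+1 w) == level%:Z])
        (iota 0 (size w)).

Definition peak_total (r n l : nat) : nat :=
  \sum_(w in An0 r n.+1) peaks_at w l.+1.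

(* Main.v *)
(* Cut a Dyck path at a peak u d at level l + 1: it is a path from height 0 to
   height l, the peak, and a path back to height 0.  Decomposing by last
   passages, paths from 0 to h have generating function z^h Z^(h+1) with
   Z(z) = S_r(z^2), since the step after u is unconstrained; paths from h to 0
   that follow a d-step of a given color have (r-1)^h z^h Z^(h+1), as each of
   the h descending steps avoids exactly one color.  Instead of decomposing
   paths we check that both counts satisfy the recurrence of these series.  The
   product of the two, times the r colors of the peak, is the Riordan entry, and
   the closed form follows since the coefficients of S_r^k and the Lagrange
   inversion terms both satisfy the recurrence read off from
   S^(k+1) = S^k + x S^(k+1) + (r-1) x S^(k+2). *)
Require Import Defs.
From HB Require Import structures.
From mathcomp Require Import all_boot all_order all_algebra ring zify.

Set Implicit Arguments.
Unset Strict Implicit.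
Unset Printing Implicit Defensive.

Import Order.TTheory GRing.Theory Num.Theory.
Local Open Scope ring_scope.

(** * Sums over words of fixed length *)

Section TupleSums.
Variables (V : nmodType) (T : finType).

Lemma sum_tuple0 (f : seq T -> V) : \sum_(w : 0.-tuple T) f w = f [::].
Proof.
rewrite (big_pred1 [tuple]) // => w; apply/esym/eqP; exact: tuple0.
Qed.

Lemma sum_tuple_cons m (f : seq T -> V) :
  \sum_(w : m.+1.-tuple T) f w = \sum_s \sum_(w : m.-tuple T) f (s :: w).
Proof.
rewrite pair_bigA /=.
rewrite (reindex (fun p : T * m.-tuple T => cons_tuple p.1 p.2)) //=.
exists (fun w : m.+1.-tuple T => (thead w, behead_tuple w)) => [[s w] | w] _ /=.
  by congr (_, _); apply: val_inj.
by case/tupleP: w => s w; apply: val_inj.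
Qed.

Lemma sum_tuple_cat m n (f : seq T -> V) :
  \sum_(w : (m + n).-tuple T) f w =
  \sum_(p : m.-tuple T) \sum_(q : n.-tuple T) f (p ++ q).
Proof.
elim: m f => [|m IH] f.
  by rewrite (sum_tuple0 (fun p => \sum_(q : n.-tuple T) f (p ++ q))).
rewrite (sum_tuple_cons m (fun p => \sum_(q : n.-tuple T) f (p ++ q))).
rewrite (sum_tuple_cons (m + n) f); apply: eq_bigr => s _.
exact: (IH (fun w => f (s :: w))).
Qed.

Lemma sum_tuple_rcons m (f : seq T -> V) :
  \sum_(w : m.+1.-tuple T) f w = \sum_s \sum_(w : m.-tuple T) f (rcons w s).
Proof.
rewrite exchange_big /= -addn1 sum_tuple_cat; apply: eq_bigr => w _.
rewrite (sum_tuple_cons 0 (fun q => f (w ++ q))); apply: eq_bigr => s _.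
by rewrite (sum_tuple0 (fun q => f (w ++ s :: q))) cats1.
Qed.

End TupleSums.

(** * Power series in z^2 and shifts by powers of the variable *)

Section Squaring.
Variable R : comNzRingType.

(* The substitution [x := z ^ 2]. *)
Definition fps_sq (f : fps R) : fps R :=
  Fps (fun n => if odd n then 0 else fcoef f n./2).

Lemma fcoef_sq_double f n : fcoef (fps_sq f) n.*2 = fcoef f n.
Proof. by rewrite /= odd_double doubleK. Qed.

Lemma sum_even (F : nat -> R) n :
  (forall i, odd i -> F i = 0) ->
  \sum_(i < n.*2.+1) F i = \sum_(i < n.+1) F i.*2.
Proof.
move=> F0; elim: n => [|n IH]; first by rewrite !big_ord1.
rewrite doubleS 2!big_ord_recr /= IH [in RHS]big_ord_recr /= F0 ?addr0 /=.
  by [].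
by rewrite odd_double.
Qed.

(** In an odd coefficient of the product one of the two indices is odd, so every term vanishes; in
    an even one only the even indices survive. *)
Lemma fps_sqM f g : fps_sq (f * g) = fps_sq f * fps_sq g.
Proof.
apply: fpsP => n; rewrite -(odd_double_half n).
case: (odd n) => /=; rewrite ?add1n ?add0n.
  rewrite odd_double /= (eq_bigr (fun=> 0)) ?big1 // => i _.
  case: ifP => [|oi]; first by rewrite mul0r.
  by rewrite oddB ?oddS ?odd_double ?oi ?mulr0 // -ltnS ltn_ord.
rewrite odd_double doubleK.
pose F i := fcoef (fps_sq f) i * fcoef (fps_sq g) (n./2.*2 - i).
rewrite -[RHS]/(\sum_(i < _) F i) sum_even; last first.
  by move=> i oi; rewrite /F /= oi mul0r.
by apply: eq_bigr => i _; rewrite /F -doubleB !fcoef_sq_double.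
Qed.

Lemma fps_sq1 : fps_sq 1 = 1.
Proof. by apply: fpsP => [[|[|n]]] //=; case: ifP. Qed.

Lemma fps_sqD f g : fps_sq (f + g) = fps_sq f + fps_sq g.
Proof. by apply: fpsP => n /=; case: ifP => //; rewrite addr0. Qed.

Lemma fps_sqXn f k : fps_sq (f ^+ k) = fps_sq f ^+ k.
Proof. by elim: k => [|k IH]; rewrite ?fps_sq1 // !exprS fps_sqM IH. Qed.

Lemma fps_sqX : fps_sq fpsX = fpsX ^+ 2 :> fps R.
Proof.
apply: fpsP => n; rewrite expr2 fcoefXM.
by case: n => [|[|[|[|n]]]] //=; case: ifP.
Qed.

Lemma fcoefXnM k (f : fps R) n :
  fcoef (fpsX ^+ k * f) (k + n) = fcoef f n.
Proof.
by elim: k => [|k IH]; rewrite ?mul1r // exprS -mulrA addSn fcoefXM.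
Qed.

Lemma fcoefXnM_lt k (f : fps R) n : (n < k)%N ->
  fcoef (fpsX ^+ k * f) n = 0.
Proof.
elim: k n => // k IH [|n] kn; rewrite exprS -mulrA fcoefXM //; exact: IH.
Qed.

End Squaring.

Lemma fcoefNatM (k : nat) (f : fps rat) n : fcoef (k%:R * f) n = k%:R * fcoef f n.
Proof.
rewrite !mulr_natl; elim: k => [|k IH]; first by rewrite !mulr0n.
by rewrite !mulrS fcoefD IH.
Qed.

(** * Lagrange inversion terms and their recurrence *)

Section LagrangeCoefficients.

(* Indexed by [i = m - j] instead of [m] to avoid truncated subtractions
   in the recurrence; see [lagrE]. *)
Definition lagr (k i j : nat) : rat :=
  k%:R * (2 * i + j + k).-1`!%:R / ((i + k)`!%:R * j`!%:R * i`!%:R).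

Lemma natr_fact_neq0 n : n`!%:R != 0 :> rat.
Proof. by rewrite pnatr_eq0 -lt0n fact_gt0. Qed.

Lemma lagr0 i j : lagr 0 i j = 0. Proof. by rewrite /lagr !mul0r. Qed.

Lemma lagrS00 k : lagr k.+1 0 0 = 1.
Proof.
rewrite /lagr /= !add0n fact0 !mulr1 factS natrM divff //.
by rewrite mulf_neq0 ?natr_fact_neq0 ?pnatr_eq0.
Qed.

(** Over the denominator (i+k+1)! j! i!, with N = 2i+j+k-1, this is N! times the identity
    (k+1)(2i+j+k) = k(i+k+1) + (k+1)j + (k+2)i. *)
Lemma lagr_rec k i j : (0 < i + j)%N ->
  lagr k.+1 i j = lagr k i j + (if j is j'.+1 then lagr k.+1 i j' else 0)
                             + (if i is i'.+1 then lagr k.+2 i' j else 0).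
Proof.
move=> ij; rewrite [LHS]/lagr.
have F := natr_fact_neq0.
have [N EN] : exists N, (2 * i + j + k = N.+1)%N.
  by exists (2 * i + j + k).-1; lia.
rewrite !addnS /= EN factS natrM /=.
have ENr : N.+1%:R = 2 * i%:R + j%:R + k%:R :> rat by rewrite -EN 2!natrD natrM.
have H1 : (i + k).+1`!%:R = (i%:R + k%:R + 1) * (i + k)`!%:R :> rat.
  by rewrite factS natrM -addn1 !natrD.
have H0 : i%:R + k%:R + 1 != 0 :> rat by rewrite -natrD natr1 pnatr_eq0.
have -> : lagr k i j = k%:R * N`!%:R / ((i + k)`!%:R * j`!%:R * i`!%:R).
  by rewrite /lagr EN.
(* The factor [j%:R] makes one formula cover both branches; likewise [i%:R] below. *)
have -> : (if j is j'.+1 then lagr k.+1 i j' else 0) =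
   k.+1%:R * j%:R * N`!%:R / ((i + k).+1`!%:R * j`!%:R * i`!%:R).
  case: j EN {ij ENr} => [|j] EN; first by rewrite mulr0 !mul0r.
  rewrite /lagr (_ : (2 * i + j + k.+1).-1 = N)%N; last by lia.
  rewrite addnS.
  have Hj : j.+1%:R != 0 :> rat by rewrite pnatr_eq0.
  rewrite (factS j) natrM; field.
  by rewrite !F (_ : 1 + j%:R = j.+1%:R) ?Hj // -addn1 natrD addrC.
have -> : (if i is i'.+1 then lagr k.+2 i' j else 0) =
   k.+2%:R * i%:R * N`!%:R / ((i + k).+1`!%:R * j`!%:R * i`!%:R).
  case: i EN {ij ENr H1 H0} => [|i] EN; first by rewrite mulr0 !mul0r.
  rewrite /lagr (_ : (2 * i + j + k.+2).-1 = N)%N; last by lia.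
  have Hi : i.+1%:R != 0 :> rat by rewrite pnatr_eq0.
  rewrite (_ : i + k.+2 = (i.+1 + k).+1)%N; last by lia.
  rewrite (factS i) natrM; field.
  by rewrite !F (_ : 1 + i%:R = i.+1%:R) ?Hi // -addn1 natrD addrC.
rewrite ENr H1 -(addn2 k) -(addn1 k) !natrD; field.
by rewrite !F H0.
Qed.

Lemma lagrE k m j : (j <= m)%N -> (0 < k)%N ->
  k%:R / (2 * m - j + k)%N%:R * 'C(2 * m - j + k, m)%:R * 'C(m, j)%:R
  = lagr k (m - j) j.
Proof.
move=> jm k0; rewrite /lagr.
have F := natr_fact_neq0.
have [N EN] : exists N, (2 * m - j + k = N.+1)%N.
  by exists (2 * m - j + k).-1; lia.
have -> : (2 * (m - j) + j + k = N.+1)%N by lia.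
have B1 : 'C(N.+1, m)%:R = N.+1%:R * N`!%:R / (m`!%:R * (m - j + k)`!%:R) :> rat.
  rewrite -natrM -factS -(@bin_fact N.+1 m); last by lia.
  rewrite (_ : N.+1 - m = m - j + k)%N; last by lia.
  by rewrite 2!natrM mulfK // mulf_neq0.
have B2 : 'C(m, j)%:R = m`!%:R / (j`!%:R * (m - j)`!%:R) :> rat.
  by rewrite -(bin_fact jm) !natrM mulfK // mulf_neq0.
rewrite EN B1 B2 /=; field.
by rewrite !F nat1r pnatr_eq0.
Qed.

End LagrangeCoefficients.

(** * Powers of S_r and the path recurrence *)

Definition shift (f : nat -> rat) (n : nat) : rat :=
  if n is n'.+1 then f n' else 0.

(* Removing the last step from a path of length [m.+1] from height [0] to [h]:
   either it is u, or it is d with [y = r - 1] colors generically available;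
   the last summand corrects for the extra color allowed after u. *)
Definition path_rec (y : rat) (g : nat -> nat -> rat) : Prop :=
  (forall h, g h 0%N = (h == 0%N)%:R) /\
  (forall h m, g h m.+1 = shift (g^~ m) h + y * g h.+1 m + shift (g h) m).

Section Powers.
Variable r : nat.
Let y : rat := r%:R - 1.

Lemma fcoef_yM (f : fps rat) n : fcoef ((r%:R - 1) * f) n = y * fcoef f n.
Proof.
by rewrite mulrBl mul1r fcoefD fcoefNatM /y mulrBl mul1r.
Qed.

Lemma Sr_exprS k :
  Sr r ^+ k.+1 = Sr r ^+ k + fpsX * (Sr r ^+ k.+1 + (r%:R - 1) * Sr r ^+ k.+2).
Proof. by rewrite exprS {1}Sr_eq !exprS; ring. Qed.

Lemma fcoef_Sr_expr0 k : fcoef (Sr r ^+ k) 0 = 1.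
Proof. by elim: k => // k IH; rewrite Sr_exprS fcoefD fcoefXM addr0. Qed.

Lemma fcoef_Sr_exprS k m :
  fcoef (Sr r ^+ k.+1) m.+1 =
  fcoef (Sr r ^+ k) m.+1 + (fcoef (Sr r ^+ k.+1) m + y * fcoef (Sr r ^+ k.+2) m).
Proof. by rewrite [in LHS]Sr_exprS fcoefD fcoefXM fcoefD fcoef_yM. Qed.

(** Outer induction on m, inner on k: [fcoef_Sr_exprS] lowers either k at the same m, or m. The case
    k = m = 0 is excluded because [lagr 0] vanishes while S^0 has constant term 1. *)
Lemma fcoef_Sr_expr k m : (0 < k + m)%N ->
  fcoef (Sr r ^+ k) m = \sum_(j < m.+1) lagr k (m - j) j * y ^+ (m - j).
Proof.
elim: m k => [|m IHm] k.
  rewrite addn0 fcoef_Sr_expr0 big_ord1; case: k => // k _.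
  by rewrite lagrS00 mul1r.
move=> _; elim: k => [|k IHk].
  by rewrite big1 // => j _; rewrite lagr0 mul0r.
rewrite fcoef_Sr_exprS IHk !IHm //.
(* The second summand vanishes at j = 0 and reindexes to the sum for S^(k+1); the third vanishes at
   j = m+1 and releases one factor y. *)
have -> : \sum_(j < m.+2) lagr k.+1 (m.+1 - j) j * y ^+ (m.+1 - j) =
  \sum_(j < m.+2) (lagr k (m.+1 - j) j * y ^+ (m.+1 - j)
    + (if (j : nat) is j'.+1 then lagr k.+1 (m.+1 - j) j' else 0) * y ^+ (m.+1 - j)
    + (if (m.+1 - j)%N is i'.+1 then lagr k.+2 i' j else 0) * y ^+ (m.+1 - j)).
  apply: eq_bigr => j _; rewrite -!mulrDl -lagr_rec //.
  by rewrite subnK // -ltnS ltn_ord.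
rewrite !big_split /= -addrA; congr (_ + (_ + _)).
  by rewrite [RHS]big_ord_recl /= mul0r add0r.
rewrite [RHS]big_ord_recr /= subnn mul0r addr0 mulr_sumr.
apply: eq_bigr => j _; rewrite subSn; last by rewrite -ltnS ltn_ord.
by rewrite exprS mulrCA.
Qed.

(* The variable marks single steps here, whereas [Sr] counts by semilength. *)
Definition Sr_sq : fps rat := fps_sq (Sr r).
Definition path_gf h : fps rat := fpsX ^+ h * Sr_sq ^+ h.+1.

Lemma Sr_sq_eq : Sr_sq = 1 + fpsX ^+ 2 * Sr_sq + (r%:R - 1) * fpsX ^+ 2 * Sr_sq ^+ 2.
Proof.
have yE : fps_sq (r%:R - 1) = r%:R - 1 :> fps rat.
  have cE n : fcoef (r%:R - 1 : fps rat) n = y * (n == 0%N)%:R.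
    by rewrite -[r%:R - 1]mulr1 fcoef_yM.
  apply: fpsP => n; rewrite cE.
  rewrite -[LHS]/(if odd n then 0 else fcoef (r%:R - 1 : fps rat) n./2) cE.
  by case: n => [|[|n]] //=; rewrite mulr0 ?if_same.
rewrite {1}/Sr_sq Sr_eq !fps_sqD (@fps_sq1 rat) !fps_sqM (@fps_sqX rat) yE.
by [].
Qed.

(** This is [Sr_sq_eq] multiplied by z^h Z^h. *)
Lemma path_gfE h :
  path_gf h = (if h is h'.+1 then fpsX * path_gf h' else 1)
        + fpsX * ((r%:R - 1) * path_gf h.+1) + fpsX * (fpsX * path_gf h).
Proof.
rewrite {1}/path_gf exprS {1}Sr_sq_eq; case: h => [|h]; rewrite /path_gf !exprS; ring.
Qed.

Lemma fcoef_path_gf0 h : fcoef (path_gf h) 0 = (h == 0%N)%:R.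
Proof.
by rewrite path_gfE !fcoefD !fcoefXM !addr0; case: h => [|h] //; rewrite fcoefXM.
Qed.

Lemma path_gf_rec : path_rec y (fun h => fcoef (path_gf h)).
Proof.
split=> [h|h m]; first exact: fcoef_path_gf0.
have coefS (A B C : fps rat) :
    fcoef (A + fpsX * ((r%:R - 1) * B) + fpsX * (fpsX * C)) m.+1 =
    fcoef A m.+1 + y * fcoef B m + shift (fcoef C) m.
  by rewrite 2!fcoefD 2!fcoefXM fcoef_yM fcoefXM.
rewrite {1}path_gfE coefS; congr (_ + _ + _) => //.
by case: h => [|h] //; rewrite fcoefXM.
Qed.

Lemma fcoef_path_gfM n l :
  fcoef (path_gf l * path_gf l) n.*2 =
  if (l <= n)%N then fcoef (Sr r ^+ (2 * l.+1)) (n - l) else 0.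
Proof.
have -> : path_gf l * path_gf l = fps_sq (fpsX ^+ l * Sr r ^+ (2 * l.+1)).
  rewrite fps_sqM !fps_sqXn (@fps_sqX rat) /path_gf -exprM -/Sr_sq.
  by rewrite !mulSn !mul0n !addn0 !exprD; ring.
rewrite fcoef_sq_double; case: leqP => nl; last by rewrite fcoefXnM_lt.
by rewrite -{1}(subnKC nl) fcoefXnM.
Qed.

End Powers.

(** * Counting the path pieces before and after a peak *)

Section Walks.
Variable r : nat.
Let y : rat := r%:R - 1.
Implicit Types (s t : step r) (p q w : seq (step r)).

Definition compat s t : bool := ~~ [&& is_d s, is_d t & s == t].

(** Failing as soon as the axis is crossed turns the condition on all prefixes into a recursion that
    splits along concatenation. *)
Fixpoint walk (h : nat) w : option nat :=
  match w with
  | [::] => Some h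
  | None :: w' => walk h.+1 w'
  | Some _ :: w' => if h is h'.+1 then walk h' w' else None
  end.

Lemma walk_cat h p q : walk h (p ++ q) = obind (walk^~ q) (walk h p).
Proof. by elim: p h => [|[c|] p IH] //= [|h] //=. Qed.

Lemma ordinate_cons s w :
  ordinate (s :: w) = (if is_u s then 1 else - 1) + ordinate w.
Proof. exact: big_cons. Qed.

Lemma ordinate_rcons w s :
  ordinate (rcons w s) = ordinate w + (if is_u s then 1 else - 1).
Proof. exact: big_rcons. Qed.

Lemma walk_ordinate h w k :
  (walk h w == Some k) = (h%:Z + ordinate w == k%:Z) &&
    all (fun i => 0 <= h%:Z + ordinate (take i w)) (iota 0 (size w).+1).
Proof.
elim: w h => [|s w IH] h; first by rewrite /= /ordinate big_nil addr0 le0z_nat !andbT.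
have -> : all (fun i => 0 <= h%:Z + ordinate (take i (s :: w)))
     (iota 0 (size (s :: w)).+1) =
   all (fun i => 0 <= h%:Z + (if is_u s then 1 else - 1) + ordinate (take i w))
     (iota 0 (size w).+1).
  rewrite -[iota 0 (size _).+1]/(0%N :: iota (1 + 0) (size w).+1) iotaDl.
  rewrite -[0%N :: _]cat1s all_cat all_seq1 all_map take0 {1}/ordinate big_nil addr0 le0z_nat.
  by apply: eq_all => i; rewrite -addrA -ordinate_cons.
rewrite ordinate_cons addrA; case: s => [c|] /=; last first.
  by rewrite IH -(addn1 h) PoszD.
(* A d-step from height 0 already makes the prefix of length 1 negative. *)
case: h => [|h].
  by rewrite /ordinate take0 big_nil andbF.
by rewrite IH -(addn1 h) PoszD addrK.
Qed.

(** A virtual u-step in front is compatible with any first step. *)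
Lemma no_mono_ddE w : no_mono_dd w = path compat None w.
Proof. by case: w. Qed.

Lemma dyckE w : dyck w = (walk 0 w == Some 0%N).
Proof.
by rewrite walk_ordinate /dyck add0r; congr (_ && _); apply: eq_all => i; rewrite add0r.
Qed.

Lemma sum_step (F : step r -> rat) : \sum_s F s = F None + \sum_c F (Some c).
Proof.
rewrite (bigD1 None) //=; congr (_ + _).
rewrite (reindex_omap Some id) //=; last by case.
by apply: eq_bigl => c; rewrite eqxx.
Qed.

Lemma sum_compat s :
  \sum_(c < r) (compat s (Some c))%:R = if is_u s then r%:R else y.
Proof.
case: s => [c|] /=; last by rewrite sumr_const card_ord.
rewrite (eq_bigr (fun d => 1 - (d == c)%:R)); last first.
  by move=> d _; rewrite /compat /= (inj_eq Some_inj) eq_sym; case: eqP; rewrite ?subrr ?subr0.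
rewrite big_split /= sumr_const card_ord sumrN (bigD1 c) //= eqxx big1 ?addr0 //.
by move=> d /negPf ->.
Qed.

Definition prefix_good h p := (walk 0 p == Some h) && path compat None p.
Definition suffix_good h s q := (walk h q == Some 0%N) && path compat s q.

Definition prefixes m h : rat :=
  \sum_(p : m.-tuple (step r)) (prefix_good h p)%:R.
(** The colors open to a next d-step depend on the last step, so this count is carried along to
    close the recursion; the d-step is not included in m, and h is the height before it. *)
Definition prefixes_d m h : rat :=
  \sum_(p : m.-tuple (step r)) \sum_(c < r)
    (prefix_good h p && compat (last None p) (Some c))%:R.
Definition suffixes s m h : rat :=
  \sum_(q : m.-tuple (step r)) (suffix_good h s q)%:R.

Lemma prefix_good_rcons h p s :
  prefix_good h (rcons p s) =
  match s with
  | None => if h is h'.+1 then prefix_good h' p else false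
  | Some c => prefix_good h.+1 p && compat (last None p) (Some c)
  end.
Proof.
rewrite /prefix_good -cats1 walk_cat cat_path /= andbT.
case: (walk 0 p) => [k|] /=; last by case: s; case: h.
have E a b : (Some a == Some b :> option nat) = (a == b) by [].
case: s => [c|].
  by case: k => [|k] /=; rewrite ?E ?eqSS ?andbA.
by case: h => [|h]; rewrite ?E ?eqSS // /compat andbF andbT.
Qed.

Lemma prefixesS m h :
  prefixes m.+1 h = (if h is h'.+1 then prefixes m h' else 0) + prefixes_d m h.+1.
Proof.
rewrite /prefixes (sum_tuple_rcons m (fun p => (prefix_good h p)%:R)) sum_step.
congr (_ + _).
  case: h => [|h]; last by apply: eq_bigr => p _; rewrite prefix_good_rcons.
  by rewrite big1 // => p _; rewrite prefix_good_rcons.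
rewrite exchange_big; apply: eq_bigr => p _; apply: eq_bigr => c _.
by rewrite prefix_good_rcons.
Qed.

Lemma prefixes_dE m h : prefixes_d m h =
  \sum_(p : m.-tuple (step r)) (prefix_good h p)%:R *
    (if is_u (last None p) then r%:R else y).
Proof.
apply: eq_bigr => p _; rewrite -sum_compat mulr_sumr; apply: eq_bigr => c _.
by rewrite -natrM mulnb.
Qed.

(** Every prefix admits y = r - 1 colors, and those ending in u admit one more. *)
Lemma prefixes_dS m h :
  prefixes_d m.+1 h =
  y * prefixes m.+1 h + (if h is h'.+1 then prefixes m h' else 0).
Proof.
rewrite prefixesS prefixes_dE.
rewrite (sum_tuple_rcons m (fun p => (prefix_good h p)%:R *
    (if is_u (last None p) then r%:R else y))) sum_step.
have -> : \sum_(p : m.-tuple (step r)) (prefix_good h (rcons p None))%:R *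
    (if is_u (last None (rcons p None)) then r%:R else y) =
    (if h is h'.+1 then prefixes m h' else 0) * r%:R.
  case: h => [|h].
    by rewrite big1 ?mul0r // => p _; rewrite prefix_good_rcons mul0r.
  by rewrite mulr_suml; apply: eq_bigr => p _; rewrite prefix_good_rcons last_rcons.
have -> : \sum_c \sum_(p : m.-tuple (step r)) (prefix_good h (rcons p (Some c)))%:R *
    (if is_u (last None (rcons p (Some c))) then r%:R else y) = y * prefixes_d m h.+1.
  rewrite exchange_big mulr_sumr; apply: eq_bigr => p _.
  rewrite mulr_sumr; apply: eq_bigr => c _.
  by rewrite prefix_good_rcons last_rcons mulrC.
by case: h => [|h]; rewrite /y; ring.
Qed.

Lemma prefixes_d0 h : prefixes_d 0 h.+1 = 0.
Proof.
rewrite prefixes_dE (sum_tuple0 (fun p => (prefix_good h.+1 p)%:R *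
    (if is_u (last None p) then r%:R else y))).
by rewrite mul0r.
Qed.

(** Joint induction on m with [prefixes_d], at positive heights only: a d-step must start above the
    axis. *)
Lemma prefixes_path_rec g m h : path_rec y g -> prefixes m h = g h m.
Proof.
case=> g0 gS.
suff: (forall h, prefixes m h = g h m) /\
      (forall h, prefixes_d m h.+1 = y * g h.+1 m + shift (g h) m).
  by case=> + _; apply.
elim: m {h} => [|m [IH IHd]].
  split=> h; last by rewrite prefixes_d0 g0 mulr0 addr0.
  rewrite /prefixes (sum_tuple0 (fun p => (prefix_good h p)%:R)) g0.
  by rewrite /prefix_good /= andbT eq_sym.
have IH' h : prefixes m.+1 h = g h m.+1.
  by rewrite prefixesS IHd gS addrA; case: h => [|h]; rewrite ?IH.
by split=> // h; rewrite prefixes_dS IH' IH.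
Qed.

Lemma suffixesS s m h :
  suffixes s m.+1 h = suffixes None m h.+1 +
    if h is h'.+1 then \sum_c (compat s (Some c))%:R * suffixes (Some c) m h'
    else 0.
Proof.
rewrite /suffixes (sum_tuple_cons m (fun q => (suffix_good h s q)%:R)) sum_step.
congr (_ + _).
  by apply: eq_bigr => q _; rewrite /suffix_good /= /compat andbF.
case: h => [|h].
  by rewrite big1 // => c _; rewrite big1.
apply: eq_bigr => c _; rewrite mulr_sumr; apply: eq_bigr => q _.
by rewrite -natrM mulnb /suffix_good /= andbCA.
Qed.

(** Joint induction on m with the suffixes after a u-step, which start at positive height. There r =
    y + 1 colors are open to a d-step, which yields the extra term y^h [shift (g h) m]. *)
Lemma suffixes_path_rec g c m h :
  path_rec y g -> suffixes (Some c) m h = y ^+ h * g h m.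
Proof.
case=> g0 gS.
suff: (forall c h, suffixes (Some c) m h = y ^+ h * g h m) /\
      (forall h, suffixes None m h.+1 =
         y ^+ h.+1 * g h.+1 m + y ^+ h * shift (g h) m).
  by case=> + _; apply.
elim: m {c h} => [|m [IH IHu]].
  have S0 s h : suffixes s 0 h = (h == 0%N)%:R.
    rewrite /suffixes (sum_tuple0 (fun q => (suffix_good h s q)%:R)).
    by rewrite /suffix_good /= andbT.
  split=> [c h|h]; rewrite S0 g0 ?mulr0 ?addr0 //.
  by case: h => [|h]; rewrite ?mulr0 ?mulr1.
have Sc s h : \sum_c (compat s (Some c))%:R * suffixes (Some c) m h =
    (if is_u s then r%:R else y) * (y ^+ h * g h m).
  by rewrite -sum_compat mulr_suml; apply: eq_bigr => c _; rewrite IH.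
split=> [c h|h]; rewrite suffixesS IHu gS.
  by case: h => [|h]; rewrite ?Sc /= ?exprS; ring.
have yr : r%:R = y + 1 by rewrite /y subrK.
by rewrite Sc /= !exprS yr; ring.
Qed.

Definition peak_at w l i : bool :=
  [&& (i.+1 < size w)%N, is_u (nth None w i), is_d (nth None w i.+1)
    & ordinate (take i.+1 w) == l%:Z].

(** The u-step of the peak is compatible with both neighbors, so the two sides interact only through
    the level l and the color of the d-step. *)
Lemma good_peak_split p s t q l :
  (dyck (p ++ s :: t :: q) && no_mono_dd (p ++ s :: t :: q)) &&
    peak_at (p ++ s :: t :: q) l.+1 (size p) =
  prefix_good l p && ((s == None) && (is_d t && suffix_good l t q)).
Proof.
rewrite dyckE no_mono_ddE walk_cat cat_path /peak_at /prefix_good /suffix_good.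
rewrite size_cat /= !addnS !ltnS leq_addr /= !nth_cat ltnn subnn ltnNge leqnSn /=.
rewrite subSnn /= take_cat ltnNge leqnSn /= subSnn /= cats1 ordinate_rcons.
case: s => [c|] /=; first by rewrite !andbF.
case: t => [c|] /=; last by rewrite !andbF.
case E: (walk 0 p) => [k|] //=.
have : walk 0 p == Some k by rewrite E.
rewrite walk_ordinate add0r => /andP[/eqP -> _].
rewrite (_ : (k%:Z + 1 == l.+1%:Z) = (k == l)); last first.
  by rewrite -[1]/(1%:Z) -PoszD addn1 eqz_nat eqSS.
rewrite (inj_eq Some_inj) /compat /= andbF /=.
case: (k =P l) => [->|_]; last by rewrite andbF.
by rewrite andbT /=; case: (path _ None p); rewrite ?andbT ?andbF.
Qed.

End Walks.

(** * From peak counts to powers of S_r, the Riordan array and the closed form *)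

Section PeakTotal.
Variable r : nat.
Let y : rat := r%:R - 1.

Lemma peaks_atE (w : seq (step r)) l m : size w = m ->
  (peaks_at w l)%:R = \sum_(i < m) (peak_at w l i)%:R :> rat.
Proof.
move=> <-; rewrite /peaks_at -sum1_count natr_sum.
rewrite big_mkcond (_ : iota 0 (size w) = index_iota 0 (size w)); last first.
  by rewrite /index_iota subn0.
rewrite big_mkord.
by apply: eq_bigr => i _; rewrite /peak_at; case: ifP.
Qed.

(** Exchange the sums over paths and peak positions, then cut each word at position i. *)
Lemma peak_total_conv n l : (peak_total r n l)%:R =
  \sum_(i < n.*2.+1) prefixes r i l * \sum_(c < r) suffixes (Some c) (n.*2 - i) l.
Proof.
pose F i (w : seq (step r)) : rat :=
  ((dyck w && no_mono_dd w) && peak_at w l.+1 i)%:R.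
have FE i (p : i.-tuple (step r)) s t q : F i (p ++ s :: t :: q) =
    (prefix_good l p && ((s == None) && (is_d t && suffix_good l t q)))%:R.
  by rewrite /F -good_peak_split size_tuple.
have cast m m' f : m = m' ->
   \sum_(w : m.-tuple (step r)) f (w : seq (step r)) =
   \sum_(w : m'.-tuple (step r)) f (w : seq (step r)) :> rat by move=> ->.
have -> : (peak_total r n l)%:R =
    \sum_(i < n.*2.+2) \sum_(w : (2 * n.+1).-tuple (step r)) F i w.
  rewrite /peak_total natr_sum exchange_big big_mkcond /=.
  apply: eq_bigr => w _; rewrite inE /F; case: ifP => _; last by rewrite big1.
  by rewrite (@peaks_atE w l.+1 n.*2.+2) // size_tuple; lia.
(* No peak starts at the last of the 2n+2 positions. *)
rewrite big_ord_recr /= [X in _ + X]big1 ?addr0; last first.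
  move=> w _; rewrite /F /peak_at size_tuple (_ : (_ < _)%N = false) ?andbF //.
  by lia.
apply: eq_bigr => i _.
have Em : (2 * n.+1 = i + (n.*2 - i).+2)%N by have := ltn_ord i; lia.
rewrite (cast _ _ (F i) Em) sum_tuple_cat mulr_suml; apply: eq_bigr => p _.
rewrite (sum_tuple_cons _ (fun q => F i (p ++ q))) sum_step [X in _ + X]big1 ?addr0.
  rewrite (sum_tuple_cons _ (fun q => F i (p ++ None :: q))) sum_step.
  rewrite big1 ?add0r.
    rewrite mulr_sumr; apply: eq_bigr => c _; rewrite mulr_sumr.
    apply: eq_bigr => q _; by rewrite FE -natrM mulnb.
  by move=> q _; rewrite FE /= andbF.
move=> c _; rewrite (sum_tuple_cons _ (fun q => F i (p ++ Some c :: q))).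
rewrite big1 // => t _; rewrite big1 // => q _.
by rewrite FE /= andbF.
Qed.

(** The suffix count is the same for every color, giving the factor r; the remaining convolution is
    a coefficient of a Cauchy product. *)
Lemma peak_total_Sr n l : (peak_total r n l)%:R =
  if (l <= n)%N then r%:R * y ^+ l * fcoef (Sr r ^+ (2 * l.+1)) (n - l) else 0.
Proof.
have gfP := path_gf_rec r.
rewrite peak_total_conv.
transitivity (r%:R * y ^+ l * fcoef (path_gf r l * path_gf r l) n.*2).
  rewrite fcoefM mulr_sumr; apply: eq_bigr => i _.
  rewrite (prefixes_path_rec _ _ gfP).
  rewrite (eq_bigr (fun=> y ^+ l * fcoef (path_gf r l) (n.*2 - i))); last first.
    by move=> c _; rewrite (suffixes_path_rec _ _ _ gfP).
  rewrite sumr_const card_ord -mulr_natl.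
  by move: (fcoef (path_gf r l) i) (fcoef (path_gf r l) (n.*2 - i)) => a b; ring.
by rewrite fcoef_path_gfM; case: ifP; rewrite ?mulr0.
Qed.

Lemma peak_total_riordan n l : (peak_total r n l)%:R =
  riordan (r%:R * Sr r ^+ 2) (fpsX * (r%:R - 1) * Sr r ^+ 2) n l.
Proof.
have fcoef_yXM k f m : fcoef ((r%:R - 1) ^+ k * f) m = y ^+ k * fcoef f m.
  by elim: k => [|k IH]; rewrite ?mul1r // !exprS -!mulrA fcoef_yM IH.
have -> : riordan (r%:R * Sr r ^+ 2) (fpsX * (r%:R - 1) * Sr r ^+ 2) n l =
    fcoef (r%:R * ((r%:R - 1) ^+ l * (fpsX ^+ l * Sr r ^+ (2 * l.+1)))) n.
  rewrite /riordan; congr fcoef.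
  by rewrite 2!exprMn -exprM mulnS exprD; ring.
rewrite fcoefNatM fcoef_yXM mulrA peak_total_Sr; case: leqP => nl.
  by rewrite -{2}(subnKC nl) fcoefXnM.
by rewrite fcoefXnM_lt // mulr0.
Qed.

Lemma peak_total_closed n l : (l <= n)%N ->
  (peak_total r n l)%:R =
  \sum_(0 <= j < (n - l).+1)
     (2 * r%:R * l.+1%:R) / (2 * n - j + 2)%N%:R
     * 'C(2 * n - j + 2, n - l)%:R * 'C(n - l, j)%:R
     * (r%:R - 1) ^+ (n - j) :> rat.
Proof.
move=> ln; rewrite peak_total_Sr ln fcoef_Sr_expr // big_mkord mulr_sumr.
apply: eq_bigr => j _; have jn : (j <= n - l)%N by rewrite -ltnS.
(* [lagrE] is used with k = 2(l+1) and m = n-l; the power y^l joins y^(n-l-j). *)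
rewrite -lagrE // (_ : n - j = l + (n - l - j))%N ?exprD; last by lia.
rewrite (_ : 2 * (n - l) - j + 2 * l.+1 = 2 * n - j + 2)%N; last by lia.
by rewrite natrM -/y; ring.
Qed.

End PeakTotal.

Theorem theorem5p1 (r : nat) (hr : (2 <= r)%N) :
  [/\ forall n l : nat, (l <= n)%N ->
        (peak_total r n l)%:R =
        \sum_(0 <= j < (n - l).+1)
           (2 * r%:R * l.+1%:R) / (2 * n - j + 2)%N%:R
           * 'C(2 * n - j + 2, n - l)%:R * 'C(n - l, j)%:R
           * (r%:R - 1) ^+ (n - j) :> rat,
      peak_total r 0 0 = r
    & forall n l : nat,
        (peak_total r n l)%:R =
        riordan (r%:R * Sr r ^+ 2)
                (fpsX * (r%:R - 1) * Sr r ^+ 2) n l].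
Proof.
split; [exact: peak_total_closed | | exact: peak_total_riordan].
(* At n = l = 0 only r times the constant term of S_r^2 remains. *)
apply/eqP; rewrite -(eqr_nat rat) peak_total_Sr.
by rewrite fcoef_Sr_expr0 !mulr1.
Qed.
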